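(* All pseudoarcs are homeomorphic: if $X$ and $Y$ are pseudoarcs then $X$ is homeomorphic to $Y$.
   Context: A continuum is a connected metrisable compact space. A continuum is indecomposable if it is not the union of two proper subcontinua, and a continuum $X$ is hereditarily indecomposable if all of its subcontinua are indecomposable; equivalently, for all subcontinua $Y,Z\subseteq X$ with $Y\cap Z\neq\emptyset$, either $Y\subseteq Z$ or $Z\subseteq Y$. A continuum is chainable if every open cover is refined by a chain, i.e. by an open cover which forms a (finite) path graph with respect to the overlap relation $O\cap N\neq\emptyset$ (its members can be enumerated as $O_0,\ldots,O_n$ so that $O_j\cap O_k\neq\emptyset$ if and only if $|j-k|\leq1$). A pseudoarc is a chainable hereditarily indecomposable continuum.
   Formalization: Pseudoarcs are required to have at least two points; otherwise a one-point space would be a chainable hereditarily indecomposable continuum and the claim that all pseudoarcs are homeomorphic would be false. *)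

(* Defs.v *)
From HB Require Import structures.
From mathcomp Require Import all_boot all_order all_algebra.
From mathcomp Require Import boolp classical_sets reals topology.

Set Implicit Arguments.
Unset Strict Implicit.
Unset Printing Implicit Defensive.

Local Open Scope classical_set_scope.

Definition homeomorphic (X Y : topologicalType) : Prop :=
  exists (f : X -> Y) (g : Y -> X),
    [/\ continuous f, continuous g, cancel f g & cancel g f].

Definition metrizable (R : realType) (X : topologicalType) : Prop :=
  exists M : metricType R, homeomorphic X M.

Definition continuum (R : realType) (X : topologicalType) : Prop :=
  [/\ connected [set: X], metrizable R X & compact [set: X]].

(* The subsets of X that are continua in the subspace topology: [connected] and
   [compact] are intrinsic to the subspace, and metrizability is inherited from
   X. Points are subcontinua; so is set0, which affects none of the notions
   below. *)
Definition subcontinuum (X : topologicalType) (A : set X) : Prop :=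
  connected A /\ compact A.

Definition indecomposable (X : topologicalType) (A : set X) : Prop :=
  ~ exists B C : set X,
      [/\ subcontinuum B, subcontinuum C, B `<` A, C `<` A & A = B `|` C].

Definition hereditarily_indecomposable (X : topologicalType) : Prop :=
  forall A : set X, subcontinuum A -> indecomposable A.

Definition open_cover (X : topologicalType) (C : set (set X)) : Prop :=
  C `<=` open /\ \bigcup_(O in C) O = [set: X].

Definition refines (X : topologicalType) (C D : set (set X)) : Prop :=
  forall O, C O -> exists2 N, D N & O `<=` N.

(* The two inequalities say that |j - k| <= 1; the case j = k makes every member
   nonempty. *)
Definition chain (X : topologicalType) (C : set (set X)) : Prop :=
  open_cover C /\
  exists (n : nat) (O : 'I_n.+1 -> set X),
    C = range O /\
    forall j k : 'I_n.+1,
      O j `&` O k !=set0 <-> (j <= k.+1)%N /\ (k <= j.+1)%N.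

Definition chainable (X : topologicalType) : Prop :=
  forall D : set (set X), open_cover D ->
    exists C : set (set X), chain C /\ refines C D.

(* One-point spaces satisfy the last three conditions, so nondegeneracy is
   required, as is customary for the pseudoarc. *)
Definition pseudoarc (R : realType) (X : topologicalType) : Prop :=
  [/\ exists x y : X, x <> y,
      continuum R X,
      chainable X
    & hereditarily_indecomposable X].

(* Main.v *)
Require Import Defs.
From mathcomp Require Import all_boot all_order all_algebra.
From mathcomp Require Import boolp classical_sets reals topology.
From mathcomp Require Import cardinality zify lra.

(* A back-and-forth argument. One builds finer and finer chains U of X and V of
   Y with equally many links, the k+1-st pair refining the k-th pair along the
   same map of indices; x corresponds to y when at every stage they lie in links
   with a common index, and this is the graph of a homeomorphism.

   The inductive step takes, by chainability, a fine chain of X refining U along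
   some f : [m] -> [n] that is onto and moves by at most 1, and must find a chain
   of Y refining V along the same f. Precomposing f with a walk on [m], and
   consolidating links afterwards, one may assume f 0 = 0 and f m = n. Then f is
   a composition of maps that repeat one index and of zigzags
   0 .. b, b .. b - d, b - d .. n: the shortest leg of f between two turns is
   reflected by both of its neighbours, so it can be folded away. A repetition is
   realized by normality. A zigzag is realized by hereditary indecomposability,
   which allows to cut Y into three consecutive pieces, the first two meeting
   only deep inside link b and the last two only deep inside link b - d. *)

Set Implicit Arguments.
Unset Strict Implicit.
Unset Printing Implicit Defensive.

Local Open Scope classical_set_scope.

(** * Quasicomponents and hereditary indecomposability *)

(** The sets form a filter base; a cluster point of it lies in every member, because the members are
    closed. *)
Lemma directed_closed_meet (X : topologicalType) (I : Type) (D : set I)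
    (f : I -> set X) :
  compact [set: X] -> D !=set0 ->
  (forall i j, D i -> D j -> exists2 k, D k & f k `<=` f i `&` f j) ->
  (forall i, D i -> f i !=set0) -> (forall i, D i -> closed (f i)) ->
  exists x, forall i, D i -> f i x.
Proof.
move=> Xc D0 Ddir f0 fcl.
have FF : ProperFilter (filter_from D f).
  by apply: filter_from_proper => //; apply: filter_from_filter.
have [x [_ xcl]] := Xc _ FF filterT.
exists x => i Di; apply: (fcl i Di) => B xB.
by apply: xcl => //; exists i.
Qed.

Lemma closed_separation (X : topologicalType) (A B : set X) :
  compact [set: X] -> hausdorff_space X -> closed A -> closed B ->
  A `&` B = set0 ->
  exists G, [/\ open G, A `<=` G & closure G `&` B = set0].
Proof.
move=> Xc Xh Acl Bcl AB0.
have AnB : set_nbhs A (~` B).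
  apply/set_nbhsP; exists (~` B); split => //; first exact: closed_openC.
  exact/disjoints_subset.
have [V /set_nbhsP[G [Gop AG GV]] VB] := compact_normal Xh Xc Acl AnB.
exists G; split => //; apply/disjoints_subset.
exact: subset_trans (closureS GV) VB.
Qed.

Lemma connected_clopen (X : topologicalType) (A B : set X) :
  connected [set: X] -> closed A -> closed B -> A `|` B = [set: X] ->
  A `&` B = set0 -> A !=set0 -> B !=set0 -> False.
Proof.
move=> Xconn Acl Bcl ABT AB0 A0 [b Bb].
have AE : A = ~` B.
  apply/seteqP; split; first exact/disjoints_subset.
  by move=> x nBx; have [] : (A `|` B) x by rewrite ABT.
have AT : A = [set: X].
  apply: Xconn => //.
    by exists A; rewrite ?setTI // AE; exact: closed_openC.
  by exists A; rewrite ?setTI.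
have : (A `&` B) b by rewrite AT.
by rewrite AB0.
Qed.

Definition relatively_clopen (X : topologicalType) (M C : set X) : Prop :=
  [/\ C `<=` M, closed C & closed (M `\` C)].

(** Meaningful only for [z] in [M]: otherwise no [C] contains [z], and this is the whole space. *)
Definition quasicomponent (X : topologicalType) (M : set X) (z : X) : set X :=
  [set y | forall C, relatively_clopen M C -> C z -> C y].

Lemma relatively_clopenT (X : topologicalType) (M : set X) :
  closed M -> relatively_clopen M M.
Proof. by move=> Mcl; split=> //; rewrite setDv; exact: closed0. Qed.

Lemma relatively_clopenI (X : topologicalType) (M C D : set X) :
  relatively_clopen M C -> relatively_clopen M D ->
  relatively_clopen M (C `&` D).
Proof.
move=> [CM Ccl CMcl] [DM Dcl DMcl]; split; first by move=> x [/CM].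
  exact: closedI.
by rewrite setDIr; exact: closedU.
Qed.

Lemma relatively_clopenD (X : topologicalType) (M C : set X) :
  relatively_clopen M C -> relatively_clopen M (M `\` C).
Proof. by move=> [CM Ccl CMcl]; split; rewrite ?setDD ?(setIidr CM)// => x []. Qed.

Section Quasicomponents.
Variables (X : topologicalType).
Hypotheses (Xc : compact [set: X]) (Xh : hausdorff_space X).
Variables (M : set X) (Mcl : closed M).

Lemma quasicomponent_sub (z : X) : M z -> quasicomponent M z `<=` M.
Proof. by move=> Mz y; apply => //; exact: relatively_clopenT. Qed.

Lemma quasicomponent_closed (z : X) : closed (quasicomponent M z).
Proof.
have -> : quasicomponent M z =
    \bigcap_(C in [set C | relatively_clopen M C /\ C z]) C.
  apply/seteqP; split => y Hy; first by move=> C [] /Hy.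
  by move=> C Cc Cz; exact: Hy.
by apply: closed_bigI => C [[]].
Qed.

(** Every relatively clopen [C] around [z] meets [E]: otherwise its complement in [M] would be
    relatively clopen, contain [E] and miss [z]. Compactness then gives a point of [E] common to all
    such [C]. *)
Lemma quasicomponent_meets (E : set X) (z : X) :
  closed E -> E `<=` M -> M z ->
  (forall C, relatively_clopen M C -> E `<=` C -> C z) ->
  exists2 e, E e & quasicomponent M z e.
Proof.
move=> Ecl EM Mz Ez.
have [|C D [Cc Cz] [Dc Dz]|C [Cc Cz]|C [[_ Ccl _] _]|e He] :=
  @directed_closed_meet X _ [set C | relatively_clopen M C /\ C z]
    (fun C => C `&` E) Xc.
- by exists M; split => //; exact: relatively_clopenT.
- exists (C `&` D); last by rewrite setIIl.
  by split => //; exact: relatively_clopenI.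
- apply: contrapT => /set0P/negP/negPn/eqP/disjoints_subset CE0.
  have [] // := Ez _ (relatively_clopenD Cc).
  by move=> x Ex; split; [exact: EM | move=> /CE0].
- exact: closedI.
- have MP : relatively_clopen M M /\ M z.
    by split => //; exact: relatively_clopenT.
  by exists e => [|C Cc Cz]; [case: (He _ MP) | case: (He C)].
Qed.

(** By normality, a splitting of the quasicomponent into two closed pieces yields a relatively
    clopen set that contains [z] and misses one of the pieces. *)
Lemma quasicomponent_connected (z : X) : M z ->
  connected (quasicomponent M z).
Proof.
move=> Mz; set Q := quasicomponent M z.
(* It suffices to treat two disjoint closed pieces, the first of which contains [z]. *)
suff splitQ A B : closed A -> closed B -> A `&` B = set0 -> A `|` B = Q ->
    A z -> B = set0.
  move=> A A0 [C Cop AC] [D Dcl AD].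
  pose B := Q `&` ~` C.
  have Qcl : closed Q := @quasicomponent_closed z.
  have Acl : closed A by rewrite AD; exact: closedI.
  have Bcl : closed B by apply: closedI => //; exact: open_closedC.
  have AB0 : A `&` B = set0 by rewrite AC; apply/seteqP; split => // x [[? ?] []].
  have ABQ : A `|` B = Q by rewrite AC /B -setIUr setUv setIT.
  have Qz : Q z by move=> ? _.
  have : (A `|` B) z by rewrite ABQ.
  move=> [Az|Bz].
    by rewrite -ABQ (splitQ A B) ?setU0.
  rewrite setIC in AB0; rewrite setUC in ABQ.
  by case: A0 => x; rewrite (splitQ B A).
move=> Acl Bcl AB0 ABQ Az.
have [G [Gop AG GB0]] := closed_separation Xc Xh Acl Bcl AB0.
(* By compactness some relatively clopen set around z avoids the boundary of G,
   so its trace on G is again relatively clopen. *)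
have [C [[CM Ccl CMcl] Cz] CG] : exists2 C,
    relatively_clopen M C /\ C z & C `&` (closure G `\` G) = set0.
  apply: contrapT => /forall2NP noC.
  have [|C D [Cc Cz] [Dc Dz]|C [Cc Cz]|C [[_ Ccl _] _]|e He] :=
    @directed_closed_meet X _ [set C | relatively_clopen M C /\ C z]
    (fun C => C `&` (closure G `\` G)) Xc.
  - by exists M; split => //; exact: relatively_clopenT.
  - exists (C `&` D); last by rewrite setIIl.
    by split => //; exact: relatively_clopenI.
  - by apply/set0P/negP => /eqP C0; case: (noC C) => nC; apply: nC.
  - apply: closedI => //; apply: closedI; first exact: closed_closure.
    exact: open_closedC.
  - have Qe : Q e by move=> C Cc Cz; case: (He C).
    have MP : relatively_clopen M M /\ M z.
      by split => //; exact: relatively_clopenT.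
    have [_ [Ge nGe]] := He _ MP.
    move: Qe; rewrite -ABQ => -[/AG//|Be].
    by have : (closure G `&` B) e by []; rewrite GB0.
have CGE : C `&` G = C `&` closure G.
  apply/seteqP; split => x [Cx Gx]; split => //; first exact: subset_closure.
  apply: contrapT => nGx.
  by have : (C `&` (closure G `\` G)) x by []; rewrite CG.
have CGc : relatively_clopen M (C `&` G).
  split; first by move=> x [/CM].
    by rewrite CGE; apply: closedI => //; exact: closed_closure.
  rewrite setDIr; have -> : M `\` C `|` M `\` G = M `\` C `|` (M `&` ~` G) by [].
  by apply: closedU => //; apply: closedI => //; exact: open_closedC.
apply/seteqP; split => // x Bx.
have Qx : Q x by rewrite -ABQ; right.
have [_ Gx] := Qx _ CGc (conj Cz (AG _ Az)).
have : (closure G `&` B) x by split => //; exact: subset_closure.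
by rewrite GB0.
Qed.

End Quasicomponents.

(** If neither set contained the other, both would be proper in their union, which would be a
    decomposable subcontinuum. *)
Lemma hereditarily_indecomposable_nested (X : topologicalType) (A B : set X) :
  hereditarily_indecomposable X -> subcontinuum A -> subcontinuum B ->
  A `&` B !=set0 -> A `<=` B \/ B `<=` A.
Proof.
move=> XHI [Aconn Ac] [Bconn Bc] AB0.
have ABs : subcontinuum (A `|` B).
  by split; [exact: connectedU | exact: compactU].
apply: contrapT => /not_orP[nAB nBA].
apply: (XHI _ ABs); exists A, B; split => //.
- split=> [|sAB]; first exact: subsetUl.
  by apply: nBA => x Bx; apply: sAB; right.
- split=> [|sAB]; first exact: subsetUr.
  by apply: nAB => x Ax; apply: sAB; left.
Qed.

Lemma interior_setI_sub (X : topologicalType) (A B : set X) (x : X) :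
  interior A x -> interior B x -> interior (A `&` B) x.
Proof. by move=> Ax Bx; rewrite interiorI. Qed.

Lemma open_interior_sub (X : topologicalType) (G A : set X) (x : X) :
  open G -> G `<=` A -> G x -> interior A x.
Proof. by move=> Gop GA Gx; apply: filterS GA _; exact: open_nbhs_nbhs. Qed.

(* The Krasinkiewicz-Minc characterization of hereditary indecomposability. *)
Lemma crooked_decomposition (X : topologicalType) (M N E F : set X) :
  compact [set: X] -> hausdorff_space X -> hereditarily_indecomposable X ->
  closed M -> closed N -> M `|` N = [set: X] ->
  closed E -> closed F -> E `<=` M -> F `<=` N ->
  E `&` N = set0 -> F `&` M = set0 ->
  exists X0 X1 X2 : set X,
    [/\ [/\ closed X0, closed X1 & closed X2],
        [/\ E `<=` X0, F `<=` X2 & X0 `&` X2 = set0],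
        X0 `&` X1 `&` M = set0, X1 `&` X2 `&` N = set0 &
        forall x, [\/ interior X0 x, interior X1 x | interior X2 x]].
Proof.
move=> Xc Xh XHI Mcl Ncl MNT Ecl Fcl EM FN EN0 FM0.
(* If no such pair were disjoint, some [z] would lie in all of them by compactness. The
   quasicomponents of [z] in [M] and in [N] would be subcontinua through [z] meeting [E] and [F];
   being nested, they would put a point of [E] in [N] or a point of [F] in [M]. *)
have [C [D [[Cc EC] [Dc FD] CD0]]] : exists C D,
    [/\ relatively_clopen M C /\ E `<=` C, relatively_clopen N D /\ F `<=` D &
        C `&` D = set0].
  apply: contrapT => noCD.
  have [|[C D] [C' D'] [[/= Cc EC] [Dc FD]] [[/= Cc' EC'] [Dc' FD']]
       |[C D] [/= Cc Dc]|[C D] [[[_ Ccl _] _] [[_ Dcl _] _]]|z Hz] :=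
    @directed_closed_meet X _
      [set P : set X * set X | (relatively_clopen M P.1 /\ E `<=` P.1) /\
             (relatively_clopen N P.2 /\ F `<=` P.2)]
      (fun P => P.1 `&` P.2) Xc.
  - by exists (M, N); split; split => //=; exact: relatively_clopenT.
  - exists (C `&` C', D `&` D') => /=; last by rewrite setIACA.
    by split; split; rewrite ?subsetI //; exact: relatively_clopenI.
  - by apply/set0P/negP => /eqP CD0; apply: noCD; exists C, D.
  - exact: closedI.
  have MM := relatively_clopenT Mcl; have NN := relatively_clopenT Ncl.
  have HM K : relatively_clopen M K -> E `<=` K -> K z.
    by move=> Kc EK; case: (Hz (K, N)).
  have HN K : relatively_clopen N K -> F `<=` K -> K z.
    by move=> Kc EK; case: (Hz (M, K)).
  have Mz := HM _ MM EM; have Nz := HN _ NN FN.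
  have [e Ee Qe] := quasicomponent_meets Xc Mcl Ecl EM Mz HM.
  have [f Ff Qf] := quasicomponent_meets Xc Ncl Fcl FN Nz HN.
  have subc K : closed K -> K z -> subcontinuum (quasicomponent K z).
    move=> Kcl Kz; split; first exact: quasicomponent_connected.
    by apply: subclosed_compact Xc _ => //; exact: quasicomponent_closed.
  have [|QQ|QQ] := hereditarily_indecomposable_nested XHI
    (subc _ Mcl Mz) (subc _ Ncl Nz).
  - by exists z; split => ? _.
  - have : (E `&` N) e by split => //; apply: quasicomponent_sub Nz _ (QQ _ Qe).
    by rewrite EN0.
  - have : (F `&` M) f by split => //; apply: quasicomponent_sub Mz _ (QQ _ Qf).
    by rewrite FM0.
have [CM Ccl CMcl] := Cc; have [DN Dcl DNcl] := Dc.
(* Nested neighbourhoods [G'] and [G] of [C], and [H'] and [H] of [D]. The closure of [G] meets [M]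
   only in [C], that of [H] meets [N] only in [D], and the two closures are disjoint. *)
have [|G [Gop CG GD]] :=
    @closed_separation X C ((M `\` C) `|` D) Xc Xh Ccl (closedU CMcl Dcl).
  by rewrite setIUr CD0 setU0; apply/seteqP; split => // x [? []].
have clGcl : closed (closure G) by exact: closed_closure.
have [|G' [Gop' CG' GG']] :=
    @closed_separation X C (~` G) Xc Xh Ccl (open_closedC Gop).
  by apply/disjoints_subset; rewrite setCK.
have [|H [Hop DH HD]] := @closed_separation X D ((N `\` D) `|` closure G) Xc Xh
    Dcl (closedU DNcl clGcl).
  apply/seteqP; split => // x [Dx [[]//|Gx]].
  have : (closure G `&` (M `\` C `|` D)) x by split=> //; right.
  by rewrite GD.
have [|H' [Hop' DH' HH']] :=
    @closed_separation X D (~` H) Xc Xh Dcl (open_closedC Hop).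
  by apply/disjoints_subset; rewrite setCK.
(* In [M], [closure G] is contained in [C], hence in [G'], which the middle piece avoids; likewise
   in [N] with [D] and [H']. The gap between [G'] and [G], and between [H'] and [H], lets the
   interiors cover the space. *)
exists (closure G), (~` (G' `|` H')), (closure H); split.
- split => //; last exact: closed_closure.
  by apply: open_closedC; exact: openU.
- split.
  + by move=> x /EC/CG; exact: subset_closure.
  + by move=> x /FD/DH; exact: subset_closure.
  + apply/seteqP; split => // x [Gx Hx].
    have : (closure H `&` (N `\` D `|` closure G)) x by split => //; right.
    by rewrite HD.
- apply/seteqP; split => // x [[Gx nGH] Mx].
  have [Cx|nCx] := pselect (C x); first by case: nGH; left; exact: CG'.
  have : (closure G `&` (M `\` C `|` D)) x by split=> //; left.
  by rewrite GD.
- apply/seteqP; split => // x [[nGH Hx] Nx].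
  have [Cx|nCx] := pselect (D x); first by case: nGH; right; exact: DH'.
  have : (closure H `&` (N `\` D `|` closure G)) x by split=> //; left.
  by rewrite HD.
- move=> x.
  have [Gx|nGx] := pselect (G x).
    by constructor 1; apply: (open_interior_sub Gop) => //; exact: subset_closure.
  have [Hx|nHx] := pselect (H x).
    by constructor 3; apply: (open_interior_sub Hop) => //; exact: subset_closure.
  constructor 2; apply: (@open_interior_sub _ (~` (closure G' `|` closure H'))).
  + by apply: closed_openC; apply: closedU; exact: closed_closure.
  + by move=> y nGH [Gy|Hy]; apply: nGH; [left|right]; exact: subset_closure.
  + move=> [Gx|Hx].
    * by have : (closure G' `&` ~` G) x by []; rewrite GG'.
    * by have : (closure H' `&` ~` H) x by []; rewrite HH'.
Qed.

(** * Chains of closed sets *)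

(* Read for both orders of i and j, the last clause says that links at distance
   at least 2 are disjoint. *)
Definition weak_chain (X : topologicalType) (n : nat) (V : nat -> set X) :=
  [/\ forall i, i <= n -> closed (V i),
      forall x, exists2 i, i <= n & interior (V i) x &
      forall i j x, i <= n -> j <= n -> V i x -> V j x -> j <= i.+1].

Definition private_point (X : topologicalType) (n : nat) (V : nat -> set X)
    (i : nat) (x : X) :=
  V i x /\ forall j, j <= n -> V j x -> j = i.

(** In a connected space, private points make neighbouring links meet; they also force the index map
    of a refinement to be onto. *)
Definition closed_chain (X : topologicalType) (n : nat) (V : nat -> set X) :=
  weak_chain n V /\ forall i, i <= n -> exists x, private_point n V i x.

Lemma closed_bigcup_le (X : topologicalType) (n : nat) (P : nat -> Prop)
    (V : nat -> set X) :
  (forall i, i <= n -> closed (V i)) ->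
  closed (\bigcup_(i in [set i | i <= n /\ P i]) V i).
Proof.
move=> Vcl; apply: closed_bigcup => [|i [/Vcl]//].
by apply: (@sub_finite_set _ _ `I_n.+1); [move=> i [] | exact: finite_II].
Qed.

Lemma weak_chain_cover (X : topologicalType) (n : nat) (V : nat -> set X) x :
  weak_chain n V -> exists2 i, i <= n & V i x.
Proof. by move=> [_ /(_ x)[i ni /interior_subset Vi] _]; exists i. Qed.

(** The two groups of links have closed unions that cover a connected space, so they meet. Covering
    is required of points and not of indices, so that a link without private points can be left
    out. *)
Lemma weak_chain_cut (X : topologicalType) (n : nat) (V : nat -> set X)
    (P Q : nat -> Prop) :
  connected [set: X] -> weak_chain n V ->
  (forall x, exists i, [/\ i <= n, V i x & P i \/ Q i]) ->
  (exists i, [/\ i <= n, P i & V i !=set0]) ->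
  (exists i, [/\ i <= n, Q i & V i !=set0]) ->
  exists x i j, [/\ i <= n, j <= n, P i, Q j & V i x /\ V j x].
Proof.
move=> Xconn [Vcl _ _] cover [i [ni Pi [x Vx]]] [j [nj Qj [y Vy]]].
apply: contrapT => noint.
apply: (connected_clopen Xconn (closed_bigcup_le (P := P) Vcl)
  (closed_bigcup_le (P := Q) Vcl)).
- apply/seteqP; split => // z _; have [k [nk Vk [Pk|Qk]]] := cover z.
    by left; exists k.
  by right; exists k.
- apply/seteqP; split => // z [[k [nk Pk] Vk] [l [nl Ql] Vl]].
  by apply: noint; exists z, k, l.
- by exists x, i.
- by exists y, j.
Qed.

(** Cutting between two consecutive indices gives a meeting pair of links from the two sides; as
    distant links are disjoint, it is the pair next to the cut. *)
Lemma closed_chain_adjacent (X : topologicalType) n (V : nat -> set X) i j :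
  connected [set: X] -> closed_chain n V ->
  i <= n -> j <= n -> i <= j.+1 -> j <= i.+1 -> V i `&` V j !=set0.
Proof.
move=> Xconn [Vw Vp].
wlog ij : i j / i <= j => [adj ni nj ij ji|].
  have [ij'|ij'] := leqP i j; first exact: adj.
  by rewrite setIC; apply: adj => //; lia.
move=> ni nj _ ji.
have [->|neij] := eqVneq j i.
  by rewrite setIid; have [x []] := Vp i ni; exists x.
have [x Vx] : exists x, V i x by have [x []] := Vp i ni; exists x.
have [y Vy] : exists y, V j y by have [y []] := Vp j nj; exists y.
have [||| z [k [l [nk nl ki il [Vk Vl]]]]] :=
    @weak_chain_cut X n V (fun k => k <= i) (fun k => i < k) Xconn Vw.
- move=> z; have [k nk Vk] := weak_chain_cover z Vw; exists k; split => //.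
  by have [ik|ik] := leqP k i; [left|right].
- by exists i; split => //; exists x.
- by exists j; split => //; [lia|exists y].
- have [_ _ Vd] := Vw; have := Vd _ _ _ nk nl Vk Vl => lk.
  by exists z; split; [have -> : i = k by lia | have -> : j = l by lia].
Qed.

(** Without link [i] the space would still be covered, so a link before [i] would meet a link after
    [i], at distance at least 2. *)
Lemma weak_chain_private (X : topologicalType) n (V : nat -> set X) :
  connected [set: X] -> weak_chain n V ->
  (exists x, private_point n V 0 x) -> (exists x, private_point n V n x) ->
  closed_chain n V.
Proof.
move=> Xconn Vw [p [V0 p0]] [q [Vn qn]]; split => // i ni.
apply: contrapT => noi.
have [i0|ipos] := eqVneq i 0; first by apply: noi; rewrite i0; exists p.
have [iN|iltn] := eqVneq i n; first by apply: noi; rewrite iN; exists q.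
have [||| z [k [l [nk nl ki il [Vk Vl]]]]] :=
    @weak_chain_cut X n V (fun k => k < i) (fun k => i < k) Xconn Vw.
- move=> z; have [k nk Vk] := weak_chain_cover z Vw.
  have [ki|neki] := eqVneq k i; last by exists k; split => //; lia.
  apply: contrapT => noj; apply: noi; exists z; split; first by rewrite -ki.
  move=> j nj Vj; apply: contrapT => neji; apply: noj; exists j; split => //.
  lia.
- by exists 0; split => //; [lia | exists p].
- by exists n; split => //; [lia | exists q].
- by have [_ _ Vd] := Vw; have := Vd _ _ _ nk nl Vk Vl; lia.
Qed.

(** The space is covered by closed sets [A] and [B] such that [A] avoids the links after [i] and [B]
    those before [i]. Link [i] is replaced by its traces on [A] and [B]. *)
Lemma duplicate_link (X : topologicalType) n (V : nat -> set X) (i : nat) :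
  connected [set: X] -> compact [set: X] -> hausdorff_space X ->
  (exists x y : X, x <> y) ->
  closed_chain n V -> i <= n ->
  exists W, closed_chain n.+1 W /\
    forall j, j <= n.+1 -> W j `<=` V (if j <= i then j else j.-1).
Proof.
move=> Xconn Xc Xh [x [y xy]] [Vw Vp] ni.
have [Vcl Vint Vd] := Vw.
(* For [n = 0] the only link is the whole space, and nondegeneracy provides the two points. Adding
   them to [P] and [Q] gives the new end links private points. *)
have [p [q [pq [V0 p0] [Vn qn]]]] : exists p q,
    [/\ p <> q, private_point n V 0 p & private_point n V n q].
  have [n0|npos] := eqVneq n 0.
    have Vall z : private_point n V 0 z.
      by have [j nj Vj] := weak_chain_cover z Vw; split=> [|k]; last lia;
         have <- : j = 0 by lia.
    by exists x, y; split => //; rewrite {2}n0.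
  have [p Pp] := Vp 0 isT; have [q Pq] := Vp n (leqnn n).
  exists p, q; split => // pq; move: Pp Pq; rewrite -pq => -[_ p0] [Vn _].
  by have := p0 _ (leqnn n) Vn; lia.
have cl1 : forall z : X, closed [set z].
  exact/accessible_closed_set1/hausdorff_accessible.
pose P := \bigcup_(j in [set j | j <= n /\ j < i]) V j `|` [set p].
pose Q := \bigcup_(j in [set j | j <= n /\ i < j]) V j `|` [set q].
have Pcl : closed P by apply: closedU; [exact: closed_bigcup_le | exact: cl1].
have Qcl : closed Q by apply: closedU; [exact: closed_bigcup_le | exact: cl1].
have PQ0 : P `&` Q = set0.
  apply/seteqP; split => // z [[[j [nj ji] Vj]|->] [[k [nk ik] Vk]|zq]].
  - by have := Vd _ _ _ nj nk Vj Vk; lia.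
  - by move: Vj; rewrite zq => /(qn _ nj); lia.
  - by have := p0 _ nk Vk; lia.
  - exact: pq.
have [G [Gop PG GQ]] := closed_separation Xc Xh Pcl Qcl PQ0.
have [|G' [Gop' PG' GG']] := @closed_separation _ P (~` G) Xc Xh Pcl
    (open_closedC Gop).
  by apply/disjoints_subset; rewrite setCK.
(* The interiors of [A] and [B] cover the space because [closure G'] lies in [G]. *)
pose A := closure G; pose B := ~` G'.
have Acl : closed A by exact: closed_closure.
have Bcl : closed B by exact: open_closedC.
have ABint z : interior A z \/ interior B z.
  have [Gz|nGz] := pselect (G z).
    by left; apply: open_interior_sub Gop _ Gz; exact: subset_closure.
  right; apply: (@open_interior_sub _ (~` closure G')).
  - exact/closed_openC/closed_closure.
  - by apply: subsetC; exact: subset_closure.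
  - by move=> Gz; have : (closure G' `&` ~` G) z by []; rewrite GG'.
have PB z : P z -> B z -> False by move=> /PG'.
have QA z : Q z -> A z -> False.
  by move=> Qz Az; have : (closure G `&` Q) z by []; rewrite GQ.
have VA j z : j <= n -> V j z -> A z -> j <= i.
  move=> nj Vj Az; rewrite leqNgt; apply/negP => ij.
  by apply: (QA z) => //; left; exists j.
have VB j z : j <= n -> V j z -> B z -> i <= j.
  move=> nj Vj Bz; rewrite leqNgt; apply/negP => ij.
  by apply: (PB z) => //; left; exists j.
pose W j := if j <= i then V j `&` A else V j.-1 `&` B.
have WA j : j <= i -> W j = V j `&` A by rewrite /W => ->.
have WB j : i < j -> W j = V j.-1 `&` B by rewrite /W ltnNge => /negPf ->.
exists W; split; last by move=> j _; rewrite /W; case: ifP => _ z [].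
apply: weak_chain_private => //.
- split.
  + move=> j nj; have [ji|ij] := leqP j i.
      by rewrite WA //; apply: closedI => //; apply: Vcl; lia.
    by rewrite WB //; apply: closedI => //; apply: Vcl; lia.
  + move=> z; have [l nl Vl] := Vint z.
    have Vlz := interior_subset Vl.
    have [Az|Bz] := ABint z.
      have li := VA _ _ nl Vlz (interior_subset Az).
      by exists l; [lia | rewrite WA //; exact: interior_setI_sub].
    have il := VB _ _ nl Vlz (interior_subset Bz).
    by exists l.+1; [lia | rewrite WB //; exact: interior_setI_sub].
  + move=> j k z nj nk.
    have [ji|ij] := leqP j i; have [ki|ik] := leqP k i.
    * by rewrite !WA // => -[Vj _] [Vk _]; apply: (Vd _ _ z) => //; lia.
    * rewrite WA // WB // => -[Vj Aj] [Vk Bk].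
      have nk' : k.-1 <= n by lia.
      have nj' : j <= n by lia.
      have := VA _ _ nk' Vk Aj; have := VB _ _ nj' Vj Bk; lia.
    * lia.
    * rewrite !WB // => -[Vj _] [Vk _].
      have nj' : j.-1 <= n by lia.
      have nk' : k.-1 <= n by lia.
      by have := Vd _ _ _ nj' nk' Vj Vk; lia.
- have Pp : P p by right.
  exists p; split.
    rewrite WA //; split => //.
    have [/interior_subset//|/interior_subset Bp] := ABint p.
    by case: (PB p).
  move=> j nj; have [ji|ij] := leqP j i.
    by rewrite WA // => -[Vj _]; apply: p0 => //; lia.
  by rewrite WB // => -[_ /PB]; case.
- have Qq : Q q by right.
  exists q; split.
    rewrite WB //; split => //.
    have [/interior_subset Aq|/interior_subset//] := ABint q.
    by case: (QA q).
  move=> j nj; have [ji|ij] := leqP j i.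
    by rewrite WA // => -[_ /(QA q)]; case.
  have nj' : j.-1 <= n by lia.
  by rewrite WB // => -[Vj _]; have := qn _ nj' Vj; lia.
Qed.

(* The zigzag that runs from 0 up to b, back to b - d, and up again. *)
Definition fold (b d i : nat) : nat :=
  if i <= b then i else if i <= b + d then b + b - i else i - (d + d).

Lemma fold_leg0 (b d i : nat) : i <= b -> fold b d i = i.
Proof. by rewrite /fold => ->. Qed.

Lemma fold_leg1 (b d i : nat) :
  d <= b -> b <= i <= b + d -> fold b d i + i = b + b.
Proof. by move=> db bi; rewrite /fold; do 2?case: ifP; lia. Qed.

Lemma fold_leg2 (b d i : nat) : d <= b -> b + d <= i -> fold b d i + (d + d) = i.
Proof. by move=> db bi; rewrite /fold; do 2?case: ifP; lia. Qed.

(** The three legs of the zigzag run through the traces of the links on the three pieces of a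
    crooked decomposition. Consecutive pieces meet only inside the link where the zigzag turns. *)
Lemma fold_links (X : topologicalType) n (V : nat -> set X) (b d : nat) :
  connected [set: X] -> compact [set: X] -> hausdorff_space X ->
  hereditarily_indecomposable X ->
  closed_chain n V -> 0 < d -> d <= b -> b <= n ->
  exists W, closed_chain (n + (d + d)) W /\
    forall j, j <= n + (d + d) -> W j `<=` V (fold b d j).
Proof.
move=> Xconn Xc Xh XHI [Vw Vp] d0 db bn.
have [Vcl Vint Vd] := Vw.
have [a aE] : exists a, a + d = b by exists (b - d); lia.
have an : a <= n by lia.
have [p [V0 p0]] := Vp 0 isT; have [q [Vn qn]] := Vp n (leqnn n).
(* These points keep [E] and [F] nonempty when [a = 0] or [b = n]. They are then the private points
   [p] and [q], which thus land in the first and the last piece. *)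
have [pa [Va pa0 paP]] : exists pa, [/\ V a pa,
    (forall j, j <= n -> V j pa -> j = a) & (a = 0 -> pa = p)].
  have [a0|a0] := eqVneq a 0; first by exists p; rewrite a0.
  by have [x [Vx xP]] := Vp a an; exists x; split => // a0'; rewrite a0' in a0.
have [pb [Vb pb0 pbP]] : exists pb, [/\ V b pb,
    (forall j, j <= n -> V j pb -> j = b) & (b = n -> pb = q)].
  have [b0|b0] := eqVneq b n; first by exists q; rewrite b0.
  by have [x [Vx xP]] := Vp b bn; exists x; split => // /eqP; rewrite (negPf b0).
have cl1 : forall z : X, closed [set z].
  exact/accessible_closed_set1/hausdorff_accessible.
pose U (P : nat -> Prop) := \bigcup_(j in [set j | j <= n /\ P j]) V j.
have Ucl P : closed (U P) by exact: closed_bigcup_le.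
pose M := U (fun j => j < b); pose N := U (fun j => a < j).
pose E := U (fun j => j < a) `|` [set pa].
pose F := U (fun j => b < j) `|` [set pb].
have MNT : M `|` N = [set: X].
  apply/seteqP; split => // z _; have [j nj Vj] := weak_chain_cover z Vw.
  have [jb|jb] := leqP b j; [right|left]; exists j => //; split => //; lia.
have EM : E `<=` M.
  move=> z [[j [nj ja] Vj]|->]; [exists j | exists a] => //; split => //; lia.
have FN : F `<=` N.
  move=> z [[j [nj ja] Vj]|->]; [exists j | exists b] => //; split => //; lia.
have EN0 : E `&` N = set0.
  apply/seteqP; split => // z [[[j [nj ja] Vj]|->] [k [nk ak] Vk]].
    by have := Vd _ _ _ nj nk Vj Vk; lia.
  by have := pa0 _ nk Vk; lia.
have FM0 : F `&` M = set0.
  apply/seteqP; split => // z [[[j [nj ja] Vj]|->] [k [nk ak] Vk]].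
    by have := Vd _ _ _ nk nj Vk Vj; lia.
  by have := pb0 _ nk Vk; lia.
have [X0 [X1 [X2 [[X0cl X1cl X2cl] [EX0 FX2 X02] X01 X12 Xint]]]] :=
  crooked_decomposition Xc Xh XHI (Ucl _) (Ucl _) MNT
    (closedU (Ucl _) (cl1 pa)) (closedU (Ucl _) (cl1 pb)) EM FN EN0 FM0.
have X02F z : X0 z -> X2 z -> False.
  by move=> ? ?; have : (X0 `&` X2) z by []; rewrite X02.
have V0b j z : j <= n -> V j z -> X0 z -> j <= b.
  move=> nj Vj X0z; rewrite leqNgt; apply/negP => bj.
  by apply: (X02F z) => //; apply: FX2; left; exists j.
have V2a j z : j <= n -> V j z -> X2 z -> a <= j.
  move=> nj Vj X0z; rewrite leqNgt; apply/negP => bj.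
  by apply: (X02F z) => //; apply: EX0; left; exists j.
(* [X0] avoids the links after [b], which lie in [X2], and its intersection with [X1] avoids those
   before [b], which form [M]. Link [a] is treated symmetrically. *)
have V01 j z : j <= n -> V j z -> X0 z -> X1 z -> j = b.
  move=> nj Vj X0z X1z; have jb := V0b _ _ nj Vj X0z.
  apply: contrapT => neb.
  have : (X0 `&` X1 `&` M) z by split => //; exists j => //; split => //; lia.
  by rewrite X01.
have V12 j z : j <= n -> V j z -> X1 z -> X2 z -> j = a.
  move=> nj Vj X1z X2z; have jb := V2a _ _ nj Vj X2z.
  apply: contrapT => neb.
  have : (X1 `&` X2 `&` N) z by split => //; exists j => //; split => //; lia.
  by rewrite X12.
have V1 j z : j <= n -> V j z -> X1 z -> a <= j <= b.
  move=> nj Vj X1z; apply/andP; split; rewrite leqNgt; apply/negP => lt.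
    have X0z : X0 z by apply: EX0; left; exists j.
    by have := V01 _ _ nj Vj X0z X1z; lia.
  have X2z : X2 z by apply: FX2; left; exists j.
  by have := V12 _ _ nj Vj X1z X2z; lia.
pose leg (P : bool) (Z : set X) : set X := if P then Z else set0.
(* At the turning indices [b] and [b + d] two conditions hold at once, so these links receive the
   traces of two pieces. *)
pose W j := V (fold b d j) `&`
  (leg (j <= b) X0 `|` leg (b <= j <= b + d) X1 `|` leg (b + d <= j) X2).
have legE P Z z : leg P Z z <-> P /\ Z z.
  by rewrite /leg; case: P; split => // -[].
have legcl P Z : closed Z -> closed (leg P Z).
  by rewrite /leg; case: P => // _; exact: closed0.
have fold_le j : j <= n + (d + d) -> fold b d j <= n by rewrite /fold => nj; do 2?case: ifP; lia.
have WE j z : W j z -> V (fold b d j) z /\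
    [\/ j <= b /\ X0 z, b <= j <= b + d /\ X1 z | b + d <= j /\ X2 z].
  by move=> [Vj [[|]|] /legE Hz]; split => //;
    [constructor 1|constructor 2|constructor 3].
have Wint j z : interior (V (fold b d j)) z ->
    [\/ j <= b /\ interior X0 z, b <= j <= b + d /\ interior X1 z |
        b + d <= j /\ interior X2 z] -> interior (W j) z.
  move=> Vz HX; apply: interior_setI_sub => //.
  case: HX => -[jP]; apply: filterS => t Xt.
  + by left; left; apply/legE.
  + by left; right; apply/legE.
  + by right; apply/legE.
exists W; split; last by move=> j _ z [].
apply: weak_chain_private => //.
- split.
  + move=> j nj; apply: closedI; first by apply: Vcl; exact: fold_le.
    by apply: closedU; [apply: closedU|]; exact: legcl.
  + move=> z; have [l nl Vl] := Vint z; have Vlz := interior_subset Vl.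
    have [Xz|Xz|Xz] := Xint z; have Xzz := interior_subset Xz.
    * have lb := V0b _ _ nl Vlz Xzz.
      exists l; first lia.
      by apply: Wint; [rewrite fold_leg0 | constructor 1].
    * have lb := V1 _ _ nl Vlz Xzz.
      exists (b + b - l); first lia.
      apply: Wint; last by constructor 2; split => //; lia.
      by have -> : fold b d (b + b - l) = l
        by have := @fold_leg1 b d (b + b - l) db; lia.
    * have la := V2a _ _ nl Vlz Xzz.
      exists (l + (d + d)); first lia.
      apply: Wint; last by constructor 3; split => //; lia.
      by have -> : fold b d (l + (d + d)) = l
        by have := @fold_leg2 b d (l + (d + d)) db; lia.
  + move=> j k z nj nk /WE[Vj Xj] /WE[Vk Xk].
    have fj := fold_le _ nj; have fk := fold_le _ nk.
    have jk := Vd _ _ _ fj fk Vj Vk; have kj := Vd _ _ _ fk fj Vk Vj.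
    have f0j := @fold_leg0 b d j; have f0k := @fold_leg0 b d k.
    have f1j := @fold_leg1 b d j db; have f1k := @fold_leg1 b d k db.
    have f2j := @fold_leg2 b d j db; have f2k := @fold_leg2 b d k db.
    (* On a single leg the claim is inherited from [V]. A point on two consecutive legs lies only in
       link [b] or only in link [a], which pins both indices to the turn; the outer pieces are
       disjoint. *)
    case: Xj => -[jP Xj]; case: Xk => -[kP Xk]; try lia.
    * by have := V01 _ _ fj Vj Xj Xk; have := V01 _ _ fk Vk Xj Xk; lia.
    * by case: (X02F z).
    * by have := V12 _ _ fj Vj Xj Xk; have := V12 _ _ fk Vk Xj Xk; lia.
- have X0p : X0 p.
    apply: EX0; have [/paP <-|a0] := eqVneq a 0; first by right.
    by left; exists 0 => //; split => //; lia.
  exists p; split; first by split => //; left; left; apply/legE.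
  move=> j nj /WE[Vj Xj]; have fj := fold_le _ nj; have := p0 _ fj Vj.
  case: Xj => -[jP Xj].
  + by rewrite fold_leg0.
  + by have := V01 _ _ fj Vj X0p Xj; lia.
  + by case: (X02F p).
- have X2q : X2 q.
    apply: FX2; have [/pbP <-|b0] := eqVneq b n; first by right.
    by left; exists n => //; split => //; lia.
  have foldn : fold b d (n + (d + d)) = n.
      by have := @fold_leg2 b d (n + (d + d)) db; lia.
  exists q; split.
    by split; [rewrite foldn | right; apply/legE; split => //; lia].
  move=> j nj /WE[Vj Xj]; have fj := fold_le _ nj; have := qn _ fj Vj.
  case: Xj => -[jP Xj].
  + by case: (X02F q).
  + by have := V12 _ _ fj Vj Xj X2q; lia.
  + by have := fold_leg2 db jP; lia.
Qed.

(** * Realizing patterns *)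

Definition step_map (m n : nat) (f : nat -> nat) :=
  (forall i, i <= m -> f i <= n) /\
  (forall i, i < m -> f i.+1 <= (f i).+1 /\ f i <= (f i.+1).+1).

(** * Turns of a walk on an interval of integers *)

Section Straight.
Variables (m n : nat) (f : nat -> nat).
Hypotheses (fp : step_map m n f) (fneq : forall i, i < m -> f i.+1 <> f i).

(** Consecutive values differ by exactly 1 here, so this says that the walk reverses its direction
    at [i]. *)
Definition turn i := [/\ 0 < i, i < m & f i.+1 = f i.-1].

Lemma straight_segment s t : s < t -> t <= m ->
  (forall i, s < i -> i < t -> ~ turn i) ->
  (forall k, s <= k -> k <= t -> f k = f s + (k - s)) \/
  (forall k, s <= k -> k <= t -> f k + (k - s) = f s).
Proof.
have [fn fstep] := fp.
elim: t => // t IH st tm noturn.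
have [tup tdown] := fstep t tm; have tneq := fneq tm.
have [ts|nts] := eqVneq t s.
  subst t; have [up|down] : f s.+1 = (f s).+1 \/ (f s.+1).+1 = f s by lia.
    left=> k sk kt; have [->|->] : k = s \/ k = s.+1 by lia.
      by lia.
    by lia.
  right=> k sk kt; have [->|->] : k = s \/ k = s.+1 by lia.
    by lia.
  by lia.
have lst : s < t by lia.
have ntt : f t.+1 <> f t.-1.
  by move=> E; case: (noturn t) => //; split => //; lia.
have [//||up|down] := IH lst; first lia.
- by move=> i si it; apply: noturn => //; lia.
- left=> k sk; rewrite leq_eqVlt => /predU1P[->|kt]; last by apply: up => //; lia.
  have st1 : s <= t.-1 by lia.
  have tt1 : t.-1 <= t by lia.
  by have := up _ st1 tt1; have := up _ (ltnW lst) (leqnn t); lia.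
- right=> k sk; rewrite leq_eqVlt => /predU1P[->|kt]; last by apply: down => //; lia.
  have st1 : s <= t.-1 by lia.
  have tt1 : t.-1 <= t by lia.
  by have := down _ st1 tt1; have := down _ (ltnW lst) (leqnn t); lia.
Qed.

(* Two turns at minimal distance bound a leg of the walk that both adjacent legs
   reflect entirely; at the ends of the walk this uses that it starts at its
   minimum and ends at its maximum. *)
Lemma straight_or_folded : f 0 = 0 -> f m = n ->
  (m = n /\ forall i, i <= m -> f i = i) \/
  exists b d, [/\ 0 < d, d <= b, b + (d + d) <= m &
    forall k, k <= d -> f (b - k) = f (b + k) /\
                        f (b + d + k) = f (b + d - k)].
Proof.
move=> f0 fm; have [fn fstep] := fp.
have [m0|mpos] := posnP m.
  left; split => [|i im]; first by rewrite -fm m0 f0.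
  by have -> : i = 0 by lia.
have [[t tt]|noturn] := pselect (exists t, turn t); last first.
  left; have [|up|down] := @straight_segment 0 m mpos (leqnn m).
  - by move=> i _ _ ti; apply: noturn; exists i.
  - have upE i : i <= m -> f i = i by move=> im; rewrite (up _ _ im) // f0; lia.
    by split => //; rewrite -fm upE.
  - by have := down m (leq0n m) (leqnn m); lia.
have [t0 tm _] := tt.
(* A walk with a single turn would first descend, from its minimum 0, or finally descend, to its
   maximum [n]. *)
have turns : exists d, `[< 0 < d /\ exists b, turn b /\ turn (b + d) >].
  have [[t' [tt' neq]]|only] := pselect (exists t', turn t' /\ t' <> t).
    have [lt|lt] := leqP t t'.
      exists (t' - t); apply/asboolP; split; first lia.
      by exists t; split => //; have -> : t + (t' - t) = t' by lia.
    exists (t - t'); apply/asboolP; split; first lia.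
    by exists t'; split => //; have -> : t' + (t - t') = t by lia.
  have onlyt i : i <> t -> ~ turn i by move=> nit ti; apply: only; exists i.
  have nol i : 0 < i -> i < t -> ~ turn i by move=> ? ?; apply: onlyt; lia.
  have nor i : t < i -> i < m -> ~ turn i by move=> ? ?; apply: onlyt; lia.
  have := straight_segment t0 (ltnW tm) nol.
  have := straight_segment tm (leqnn m) nor.
  have [_ _ fturn] := tt.
  move=> [up|down] [up'|down'].
  - have := up t.+1 (leqnSn t) tm; have := up' t.-1 (leq0n _) (leq_pred t).
    by have := up' t (leq0n _) (leqnn t); lia.
  - by have := down' t (leq0n _) (leqnn t); lia.
  - have := down m (ltnW tm) (leqnn m); have := fn t (ltnW tm); lia.
  - by have := down' t (leq0n _) (leqnn t); lia.
right; case: (ex_minnP turns) => d /asboolP[dpos [b [tb tbd]]] dmin.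
have far b1 b2 : turn b1 -> turn b2 -> b1 < b2 -> d <= b2 - b1.
  move=> t1 t2 lt; apply: dmin; apply/asboolP; split; first lia.
  by exists b1; split => //; have -> : b1 + (b2 - b1) = b2 by lia.
have [bpos bm fb] := tb; have [_ bdm fbd] := tbd.
have mid i : b < i -> i < b + d -> ~ turn i.
  by move=> bi ibd ti; have := far _ _ tb ti bi; lia.
have ltbd : b < b + d by lia.
have segm := straight_segment ltbd (ltnW bdm) mid.
(* Otherwise there is no turn before [b], as it would be too close to [b]. The walk then climbs from
   0 to height [b] and could not descend [d > b] steps. *)
have db : d <= b.
  rewrite leqNgt; apply/negP => bd.
  have nol i : 0 < i -> i < b -> ~ turn i.
    by move=> i0 ib ti; have := far _ _ ti tb ib; lia.
  have [up|down] := straight_segment bpos (ltnW bm) nol; last first.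
    by have := down b (leq0n b) (leqnn b); lia.
  have upb := up b (leq0n b) (leqnn b); have upb1 := up b.-1 (leq0n _) (leq_pred b).
  case: segm => [up'|down'].
    by have := up' b.+1 (leqnSn b) ltbd; lia.
  by have := down' (b + d) (leq_addr _ _) (leqnn _); lia.
(* Symmetrically, if no turn followed [b + d], the final climb to [n] would be shorter than [d], and
   [f b] would exceed [n]. *)
have bdd : b + (d + d) <= m.
  rewrite leqNgt; apply/negP => bd.
  have nor i : b + d < i -> i < m -> ~ turn i.
    by move=> i0 ib ti; have := far _ _ tbd ti i0; lia.
  have [up|down] := straight_segment bdm (leqnn m) nor; last first.
    have := down m (ltnW bdm) (leqnn m); have := fn (b + d) (ltnW bdm); lia.
  have upb := up m (ltnW bdm) (leqnn m).
  have upb1 := up (b + d).+1 (leqnSn _) bdm.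
  case: segm => [up'|down'].
    have b1 : b <= (b + d).-1 by lia.
    have b2 := up' _ b1 (leq_pred _).
    by have := up' _ (leq_addr d b) (leqnn _); lia.
  by have := down' (b + d) (leq_addr _ _) (leqnn _); have := fn b (ltnW bm); lia.
(* By minimality of [d] the walk is straight for [d] steps on each side of both turns, and its
   direction reverses at each of them. *)
exists b, d; split => // k kd.
have ltl : b - d < b by lia.
have ltr : b + d < b + d + d by lia.
have ler : b + d + d <= m by lia.
have nol i : b - d < i -> i < b -> ~ turn i.
  by move=> i0 ib ti; have := far _ _ ti tb ib; lia.
have nor i : b + d < i -> i < b + d + d -> ~ turn i.
  by move=> i0 ib ti; have := far _ _ tbd ti i0; lia.
have segl := straight_segment ltl (ltnW bm) nol.
have segr := straight_segment ltr ler nor.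
have r1 : b - d <= b - k <= b by lia.
have r2 : b <= b + k <= b + d by lia.
have r3 : b <= b + d - k <= b + d by lia.
have r4 : b + d <= b + d + k <= b + d + d by lia.
have r5 : b - d <= b.-1 <= b by lia.
have r6 : b <= b.+1 <= b + d by lia.
have r7 : b <= (b + d).-1 <= b + d by lia.
have r8 : b + d <= (b + d).+1 <= b + d + d by lia.
have r9 : b - d <= b <= b by lia.
have r10 : b <= b + d <= b + d by lia.
have inst u v (P : nat -> Prop) : (forall i, u <= i -> i <= v -> P i) ->
    forall i, u <= i <= v -> P i by move=> H i /andP[]; exact: H.
split.
  case: segl => /inst segl; case: segm => /inst segm.
  - by have := segl _ r5; have := segl _ r9; have := segm _ r6; lia.
  - by have := segl _ r1; have := segl _ r9; have := segm _ r2; lia.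
  - by have := segl _ r1; have := segl _ r9; have := segm _ r2; lia.
  - by have := segl _ r5; have := segl _ r9; have := segm _ r6; lia.
case: segm => /inst segm; case: segr => /inst segr.
- by have := segm _ r7; have := segm _ r10; have := segr _ r8; lia.
- by have := segm _ r3; have := segm _ r10; have := segr _ r4; lia.
- by have := segm _ r3; have := segm _ r10; have := segr _ r4; lia.
- by have := segm _ r7; have := segm _ r10; have := segr _ r8; lia.
Qed.

End Straight.

(** Induction on the length: a repetition or a fold is removed from [f], the shorter walk is
    realized, and the repetition or the fold is put back by refining the chain obtained. A walk with
    neither is the identity. *)
Lemma realize_walk (X : topologicalType) m n (f : nat -> nat) (V : nat -> set X) :
  connected [set: X] -> compact [set: X] -> hausdorff_space X ->
  hereditarily_indecomposable X -> (exists x y : X, x <> y) ->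
  step_map m n f -> f 0 = 0 -> f m = n -> closed_chain n V ->
  exists W, closed_chain m W /\ forall j, j <= m -> W j `<=` V (f j).
Proof.
move=> Xconn Xc Xh XHI X2; elim/ltn_ind: m f => m IH f fp f0 fm Vch.
have [fn fstep] := fp.
have [[i im fi]|fneq] := pselect (exists2 i, i < m & f i.+1 = f i).
  (* The index [i + 1], which repeats the value at [i], is skipped. *)
  pose f' j := if j <= i then f j else f j.+1.
  have fp' : step_map m.-1 n f'.
    split => j jm; rewrite /f'; first by case: ifP => _; apply: fn; lia.
    have [jlt|jge] := ltnP j i; first by rewrite (ltnW jlt) /=; apply: fstep; lia.
    have [->|nji] := eqVneq j i; first by rewrite leqnn -fi /=; apply: fstep; lia.
    have -> : (j <= i) = false by lia.
    by apply: fstep; lia.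
  have m1 : m.-1 < m by lia.
  have [||W [Wch WV]] := IH _ m1 f' fp' _ _ Vch.
  - by rewrite /f' f0.
  - rewrite /f'; case: ifP => [mi|_]; last by rewrite prednK //; lia.
    by rewrite -fm; have -> : m.-1 = i by [lia|]; rewrite -fi; congr f; lia.
  have i1 : i <= m.-1 by lia.
  have [W' [W'ch W'W]] := duplicate_link Xconn Xc Xh X2 Wch i1.
  rewrite prednK in W'ch W'W; last lia.
  exists W'; split => // j jm; apply: (subset_trans (W'W j jm)).
  have jm' : (if j <= i then j else j.-1) <= m.-1 by case: ifP; lia.
  apply: (subset_trans (WV _ jm')); rewrite /f'.
  have [ji|ij] := leqP j i; first by rewrite ji.
  have [->|nji] := eqVneq j i.+1; first by rewrite leqnn fi.
  rewrite ifF; last lia.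
  by rewrite prednK //; lia.
have fneq' i : i < m -> f i.+1 <> f i by move=> im fi; apply: fneq; exists i.
have [[mn fid]|[b [d [dpos db bm frefl]]]] := straight_or_folded fp fneq' f0 fm.
  by exists V; rewrite mn; split => // j jn; rewrite fid ?mn.
pose m' := m - (d + d); have m'E : m' + (d + d) = m by rewrite /m'; lia.
(* The [2d] indices after [b] are skipped; this still gives a walk because [f] has the same value at
   [b] and at [b + 2d]. *)
pose f' j := if j <= b then f j else f (j + (d + d)).
have fbd : f (b + (d + d)) = f b.
  have [E1 E2] := frefl _ (leqnn d); rewrite addnA E2 addnK //.
have fp' : step_map m' n f'.
  split => j jm; rewrite /f'; first by case: ifP => _; apply: fn; lia.
  have [jlt|jge] := ltnP j b; first by rewrite (ltnW jlt) /=; apply: fstep; lia.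
  have [->|nji] := eqVneq j b.
    by rewrite leqnn -fbd /= addSn; apply: fstep; lia.
  have -> : (j <= b) = false by lia.
  by rewrite addSn; apply: fstep; lia.
have mm' : m' < m by lia.
have [||W [Wch WV]] := IH _ mm' f' fp' _ _ Vch.
- by rewrite /f' f0.
- rewrite /f'; case: ifP => [mi|_]; last by rewrite m'E.
  have -> : m' = b by lia.
  by rewrite -fbd -fm; congr f; lia.
have bm' : b <= m' by lia.
have [W' [W'ch W'W]] := fold_links Xconn Xc Xh XHI Wch dpos db bm'.
rewrite m'E in W'ch W'W.
exists W'; split => // j jm; apply: (subset_trans (W'W j jm)).
have [jb|bj] := leqP j b.
  have fE := fold_leg0 d jb; rewrite fE.
  have -> : f j = f' j by rewrite /f' jb.
  by apply: WV; lia.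
have [jbd|bdj] := leqP j (b + d).
  have bjd : b <= j <= b + d by lia.
  have fE := fold_leg1 db bjd.
  have -> : f j = f' (fold b d j).
    rewrite /f' ifT; last lia.
    have kd : j - b <= d by lia.
    have [E _] := frefl _ kd.
    have -> : fold b d j = b - (j - b) by lia.
    by rewrite E; congr f; lia.
  by apply: WV; lia.
have fE := fold_leg2 db (ltnW bdj).
have -> : f j = f' (fold b d j).
  (* Up to [b + 2d] the third leg returns to indices at most [b]: reflecting in [b + d] and then in
     [b] carries [j] there. *)
  rewrite /f'; case: ifP => fb; last by congr f; lia.
  have kd : j - (b + d) <= d by lia.
  have kd' : d - (j - (b + d)) <= d by lia.
  have [_ E] := frefl _ kd; have [E' _] := frefl _ kd'.
  have -> : fold b d j = b - (d - (j - (b + d))) by lia.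
  rewrite E'; have -> : b + (d - (j - (b + d))) = b + d - (j - (b + d)) by lia.
  by rewrite -E; congr f; lia.
by apply: WV; lia.
Qed.

Lemma consolidate_links (X : topologicalType) l m (g : nat -> nat)
    (V : nat -> set X) :
  step_map l m g -> (forall i, i <= m -> exists2 j, j <= l & g j = i) ->
  closed_chain l V ->
  closed_chain m (fun i => \bigcup_(j in [set j | j <= l /\ g j = i]) V j).
Proof.
move=> [gm gstep] gsurj [[Vcl Vint Vd] Vp].
have gadj j k : j <= l -> k <= l -> k <= j.+1 -> j <= k.+1 -> g k <= (g j).+1.
  move=> jl kl kj jk.
  have [kj'|[kj'|kj']] : k = j.+1 \/ k = j \/ j = k.+1 by lia.
  - by rewrite kj'; have [] := gstep j; lia.
  - by rewrite kj'; lia.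
  - by rewrite kj'; have [] := gstep k; lia.
split; first split.
- by move=> i _; exact: closed_bigcup_le.
- move=> x; have [j jl Vj] := Vint x; exists (g j); first exact: gm.
  by apply: filterS Vj => y Vy; exists j.
- move=> i k x im km [j [jl <-] Vj] [j' [jl' <-] Vj'].
  by apply: gadj => //; [exact: Vd Vj Vj' | exact: Vd Vj' Vj].
- move=> i im; have [j jl gj] := gsurj i im; have [x [Vx Vxj]] := Vp j jl.
  exists x; split; first by exists j.
  by move=> k km [j' [jl' <-] Vj']; rewrite (Vxj j').
Qed.

Lemma realize_pattern (X : topologicalType) m n (f : nat -> nat)
    (V : nat -> set X) :
  connected [set: X] -> compact [set: X] -> hausdorff_space X ->
  hereditarily_indecomposable X -> (exists x y : X, x <> y) ->
  step_map m n f -> (forall j, j <= n -> exists2 i, i <= m & f i = j) ->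
  closed_chain n V ->
  exists W, closed_chain m W /\ forall i, i <= m -> W i `<=` V (f i).
Proof.
move=> Xconn Xc Xh XHI X2 [fn fstep] fsurj Vch.
have [p pm fp] := fsurj 0 isT; have [q qm fq] := fsurj n (leqnn n).
(* Walk from p up to m, down to 0, and up to q. *)
pose g i := if i <= m - p then p + i else
  if i <= (m - p) + m then m - (i - (m - p)) else i - (m - p + m).
pose l := (m - p) + m + q.
have gp : step_map l m g.
  split => i; rewrite /l /g; first by do 2?case: ifP; lia.
  by do 4?case: ifP; lia.
have gsurj i : i <= m -> exists2 j, j <= l & g j = i.
  (* The descending leg of [g] already visits every index. *)
  move=> im; exists ((m - p) + (m - i)); first by rewrite /l; lia.
  by rewrite /g; do 2?case: ifP; lia.
have fgp : step_map l n (f \o g).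
  have [gm gstep] := gp.
  split => i il /=; first exact/fn/gm.
  have [g1 g2] := gstep i il; have := gm _ il; have := gm _ (ltnW il).
  have [->|[->|->]] : g i.+1 = g i \/ g i.+1 = (g i).+1 \/ g i = (g i.+1).+1 by lia.
  - by lia.
  - by move=> _; exact: fstep.
  - by move=> /fstep[] *.
have [||W [Wch WV]] := realize_walk Xconn Xc Xh XHI X2 fgp _ _ Vch.
- by rewrite /= /g leq0n addn0.
- rewrite /= -fq; congr f; rewrite /g /l; do 2?case: ifP; lia.
exists (fun i => \bigcup_(j in [set j | j <= l /\ g j = i]) W j); split.
  exact: consolidate_links.
by move=> i im x [j [jl <-] Wx]; exact: (WV _ jl).
Qed.

(** * The back-and-forth construction *)

Lemma compact_finite_subcover (X : topologicalType) (G : X -> set X) :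
  compact [set: X] -> (forall x, open (G x)) -> (forall x, G x x) ->
  exists s : seq X, forall y, exists2 x, x \in s & G x y.
Proof.
move=> Xc Gop Gx; apply: contrapT => nocover.
pose f (s : seq X) : set X := \bigcap_(x in [set` s]) ~` G x.
have [|s t _ _|s _|s _|y fy] := @directed_closed_meet X _ setT f Xc.
- by exists [::].
- exists (s ++ t) => // y fy; split => x /= xs; apply: fy => /=.
    by rewrite mem_cat xs.
  by rewrite mem_cat xs orbT.
- apply: contrapT => fs0; apply: nocover; exists s => y.
  apply: contrapT => noy; apply: fs0; exists y => x xs Gxy.
  by apply: noy; exists x.
- by apply: closed_bigI => x _; exact: open_closedC.
- by apply: (fy [:: y] I y) => //=; rewrite inE.
Qed.

(** Every point has an open neighbourhood whose closure lies in some [O i]; finitely many of these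
    cover, and their closures are grouped by [i]. *)
Lemma shrink_cover (X : topologicalType) n (O : nat -> set X) :
  compact [set: X] -> hausdorff_space X ->
  (forall i, i <= n -> open (O i)) -> (forall x, exists2 i, i <= n & O i x) ->
  exists F : nat -> set X, [/\ forall i, closed (F i), forall i, F i `<=` O i &
    forall x, exists2 i, i <= n & interior (F i) x].
Proof.
move=> Xc Xh Oop Ocov.
have nbhd (x : X) : exists iG : nat * set X,
    [/\ iG.1 <= n, open iG.2, iG.2 x & closure iG.2 `<=` O iG.1].
  have [i ni Oi] := Ocov x.
  have cl1 : closed [set x].
    exact/accessible_closed_set1/hausdorff_accessible.
  have [|G [Gop xG GO]] := closed_separation Xc Xh cl1 (open_closedC (Oop i ni)).
    by apply/disjoints_subset; rewrite setCK => _ ->.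
  exists (i, G); split => //; first exact: xG.
  by move/disjoints_subset: GO; rewrite setCK.
have [iG iGP] := choice nbhd.
have [||s sP] := @compact_finite_subcover X (fun x => (iG x).2) Xc.
- by move=> x; have [] := iGP x.
- by move=> x; have [] := iGP x.
exists (fun i => \bigcup_(x in [set x | x \in s /\ (iG x).1 = i])
                   closure (iG x).2); split.
- move=> i; apply: closed_bigcup => [|x _]; last exact: closed_closure.
  by apply: (@sub_finite_set _ _ [set` s]); [move=> x [] | exact: finite_seq].
- by move=> i y [x [_ <-]]; have [_ _ _] := iGP x; apply.
- move=> y; have [x xs Gy] := sP y; have [ni Gop _ _] := iGP x.
  exists (iG x).1 => //; apply: open_interior_sub Gop _ Gy => z Gz.
  by exists x => //; exact: subset_closure.
Qed.

Definition subordinate (X : topologicalType) (D : set (set X)) n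
    (V : nat -> set X) :=
  forall i, i <= n -> exists2 A, D A & V i `<=` A.

(** Shrinking an open chain keeps distant links disjoint, but neighbours may cease to meet and links
    may become empty. *)
Lemma chainable_weak_chain (X : topologicalType) (D : set (set X)) :
  compact [set: X] -> hausdorff_space X -> chainable X -> open_cover D ->
  exists n V, weak_chain n V /\ subordinate D n V.
Proof.
move=> Xc Xh Xch Dop.
have [C [[[Cop Ccov] [n [O [CE OP]]]] CD]] := Xch D Dop.
have [||F [Fcl FO Fint]] := @shrink_cover X n (fun i => O (inord i)) Xc Xh.
- by move=> i ni; apply: Cop; rewrite CE; exists (inord i).
- move=> x; have : (\bigcup_(o in C) o) x by rewrite Ccov.
  rewrite CE => -[_ [i _ <-] Oi]; exists i; first by rewrite -ltnS.
  by rewrite inord_val.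
exists n, F; split.
  split => // i j x ni nj /FO Oi /FO Oj.
  have [] // := (OP (inord j) (inord i)).1.
    by exists x.
  by rewrite !inordK.
move=> i ni; have [|A DA OA] := CD (O (inord i)).
  by rewrite CE; exists (inord i).
by exists A => //; apply: subset_trans OA; exact: FO.
Qed.

(* A subordinate weak chain with the least number of links has private points at
   both ends, since otherwise an end link could be dropped. *)
Lemma chainable_closed_chain (X : topologicalType) (D : set (set X)) :
  connected [set: X] -> compact [set: X] -> hausdorff_space X ->
  [set: X] !=set0 -> chainable X -> open_cover D ->
  exists n V, closed_chain n V /\ subordinate D n V.
Proof.
move=> Xconn Xc Xh [x0 _] Xch Dop.
have ex : exists n, `[< exists V : nat -> set X,
    weak_chain n V /\ subordinate D n V >].
  have [n [V HV]] := chainable_weak_chain Xc Xh Xch Dop.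
  by exists n; apply/asboolP; exists V.
case: (ex_minnP ex) => n /asboolP[V [Vw VD]] nmin.
have nodrop m (W : nat -> set X) : m < n -> weak_chain m W -> subordinate D m W ->
    False.
  move=> mn Ww WD; have : n <= m by apply: nmin; apply/asboolP; exists W.
  by lia.
exists n, V; split => //; have [Vcl Vint Vd] := Vw.
have [n0|npos] := eqVneq n 0.
  have [i ni Vi] := weak_chain_cover x0 Vw.
  have p0 : exists x, private_point n V 0 x.
    exists x0; split; first by have <- : i = 0 by lia.
    by move=> j nj _; lia.
  by apply: weak_chain_private => //; rewrite [X in private_point _ _ X]n0.
apply: weak_chain_private => //; apply: contrapT => nop.
- have V01 : V 0 `<=` V 1.
    move=> x V0; apply: contrapT => nV1; apply: nop; exists x; split => // j nj Vj.
    have := Vd 0 j x (leq0n n) nj V0 Vj; have := Vd j 0 x nj (leq0n n) Vj V0.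
    have [j1|] := eqVneq j 1; first by case: nV1; rewrite -j1.
    by lia.
  apply: (@nodrop n.-1 (fun i => V i.+1)); first lia.
    split.
    + by move=> i ni; apply: Vcl; lia.
    + move=> x; have [[|i] ni Vi] := Vint x.
        by exists 0 => //; exact: filterS Vi.
      by exists i => //; lia.
    + move=> i j x ni nj Vi Vj; have ni' : i.+1 <= n by lia.
      have nj' : j.+1 <= n by lia.
      by have := Vd _ _ _ ni' nj' Vi Vj; lia.
  by move=> i ni; apply: VD; lia.
- have Vn1 : V n `<=` V n.-1.
    move=> x Vn; apply: contrapT => nV1; apply: nop; exists x; split => // j nj Vj.
    have := Vd j n x nj (leqnn n) Vj Vn.
    have [jn|] := eqVneq j n.-1; first by case: nV1; rewrite -jn.
    by lia.
  apply: (@nodrop n.-1 V); first lia.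
    split.
    + by move=> i ni; apply: Vcl; lia.
    + move=> x; have [i ni Vi] := Vint x.
      have [iN|iN] := eqVneq i n.
        by exists n.-1 => //; apply: filterS Vn1 _; rewrite -iN.
      by exists i => //; lia.
    + by move=> i j x ni nj; apply: Vd; lia.
  by move=> i ni; apply: VD; lia.
Qed.

(** The chain is taken subordinate to [D] and to the interiors of the links of [V]. Its neighbouring
    links meet, so [f] moves by at most 1; a link of [W] through a private point of [V j] must have
    [f i = j], so [f] is onto. *)
Lemma refine_closed_chain (X : topologicalType) (D : set (set X)) n
    (V : nat -> set X) :
  connected [set: X] -> compact [set: X] -> hausdorff_space X ->
  chainable X -> open_cover D -> closed_chain n V ->
  exists m W f, [/\ closed_chain m W, subordinate D m W, step_map m n f,
    forall j, j <= n -> exists2 i, i <= m & f i = j &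
    forall i, i <= m -> W i `<=` V (f i)].
Proof.
move=> Xconn Xc Xh Xch [Dop Dcov] Vch; have [[Vcl Vint Vd] Vp] := Vch.
pose D' : set (set X) := [set B | exists j A,
  [/\ j <= n, D A & B = A `&` interior (V j)]].
have D'op : open_cover D'.
  split; first by move=> _ [j [A [nj DA ->]]]; apply: openI;
    [exact: Dop | exact: open_interior].
  apply/seteqP; split => // x _; have [j nj Vj] := Vint x.
  have [A DA Ax] : (\bigcup_(A in D) A) x by rewrite Dcov.
  by exists (A `&` interior (V j)); [exists j, A | split].
have X0 : [set: X] !=set0 by have [x _] := Vp 0 isT; exists x.
have [m [W [Wch WD']]] := chainable_closed_chain Xconn Xc Xh X0 Xch D'op.
have exf i : exists j, i <= m -> j <= n /\ W i `<=` V j.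
  have [im|] := leqP i m; last by exists 0.
  have [_ [j [A [nj _ ->]]] WA] := WD' i im.
  by exists j => _; split => // x /WA[_ /interior_subset].
have [f fP] := choice exf.
have fn i : i <= m -> f i <= n by case/fP.
have WV i : i <= m -> W i `<=` V (f i) by case/fP.
exists m, W, f; split => //.
- move=> i im; have [_ [j [A [nj DA ->]]] WA] := WD' i im.
  by exists A => // x /WA[].
- split => // i im.
  have [x [Wx Wx1]] := closed_chain_adjacent Xconn Wch (ltnW im) im
    (leqW (leqnSn i)) (leqnn _).
  have [Vx Vx1] := (WV _ (ltnW im) _ Wx, WV _ im _ Wx1).
  split; first exact: Vd (fn _ (ltnW im)) (fn _ im) Vx Vx1.
  exact: Vd (fn _ im) (fn _ (ltnW im)) Vx1 Vx.
- move=> j nj; have [x [Vx xP]] := Vp j nj.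
  have [i im Wi] := weak_chain_cover x Wch.1.
  by exists i => //; apply: xP; [exact: fn | exact: WV].
Qed.

(** Metrizability is reduced here to the Hausdorff property; its other consequence, arbitrarily fine
    covers, enters through [star_fine]. *)
Definition nondegenerate_pseudoarc (X : topologicalType) :=
  [/\ connected [set: X], compact [set: X], hausdorff_space X,
      chainable X & hereditarily_indecomposable X] /\ exists x y : X, x <> y.

(** Half a step of the back-and-forth: [X] chooses a fine chain, and [Y] follows its pattern. *)
Lemma refine_matched_chains (X Y : topologicalType) (D : set (set X)) n
    (U : nat -> set X) (V : nat -> set Y) :
  nondegenerate_pseudoarc X -> nondegenerate_pseudoarc Y ->
  open_cover D -> closed_chain n U -> closed_chain n V ->
  exists m U' V' f, [/\ closed_chain m U', closed_chain m V',
    subordinate D m U' &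
    forall i, i <= m -> [/\ f i <= n, U' i `<=` U (f i) & V' i `<=` V (f i)]].
Proof.
move=> [[Xconn Xc Xh Xch _] _] [[Yconn Yc Yh _ YHI] Y2] Dop Uch Vch.
have [m [U' [f [U'ch U'D fp fsurj U'U]]]] :=
  refine_closed_chain Xconn Xc Xh Xch Dop Uch.
have [V' [V'ch V'V]] := realize_pattern Yconn Yc Yh YHI Y2 fp fsurj Vch.
exists m, U', V', f; split => // i im; split; [exact: fp.1 | exact: U'U | exact: V'V].
Qed.

(** A substitute for mesh tending to 0. Three overlapping sets occur because the limit map sees the
    link of [f x], that of a neighbourhood of [x], and that of [f x']. *)
Definition star_fine (X : topologicalType) (S : nat -> set (set X)) :=
  forall x W, nbhs x W -> exists k, forall A B C, S k A -> S k B -> S k C ->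
    A x -> A `&` B !=set0 -> B `&` C !=set0 -> C `<=` W.

Lemma metrizable_star_fine (R : realType) (X : topologicalType) :
  metrizable R X ->
  exists S : nat -> set (set X), (forall k, open_cover (S k)) /\ star_fine S.
Proof.
move=> [M [h [g [hcont gcont hK gK]]]].
pose r (k : nat) : R := (k.+1%:R^-1)%R.
have r0 k : (0 < r k)%R by rewrite /r Num.Theory.invr_gt0 Num.Theory.ltr0n.
pose S k : set (set X) := range (fun c : M => h @^-1` interior (ball c (r k))).
exists S; split => [k|x W xW].
  split.
    move=> _ [c _ <-]; move/continuousP: hcont; apply; exact: open_interior.
  apply/seteqP; split => // x _; exists (h @^-1` interior (ball (h x) (r k))).
    by exists (h x).
  by apply: nbhsx_ballx.
have /nbhs_ballP[e /= e0 eW] : nbhs (h x) (g @^-1` W).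
  by apply: gcont; rewrite hK.
(* Crossing three balls of radius [r k] covers a distance below [6 * r k]. *)
have [k rk] : exists k, (r k < e / 6%:R)%R.
  have e6 : (0 < e / 6%:R)%R by rewrite Num.Theory.divr_gt0.
  have [k] := @ltr_add_invr R 0%R (e / 6%:R)%R e6.
  by rewrite GRing.add0r => ?; exists k.
exists k => _ _ _ [a _ <-] [b _ <-] [c _ <-] ax [y [ay yb]] [z [bz cz]] w cw.
rewrite -(hK w); apply: eW.
have {}ax := interior_subset ax; have {}ay := interior_subset ay.
have {}yb := interior_subset yb; have {}bz := interior_subset bz.
have {}cz := interior_subset cz; have {}cw := interior_subset cw.
have xy := ball_triangle (ball_sym ax) ay.
have yz := ball_triangle (ball_sym yb) bz.
have zw := ball_triangle (ball_sym cz) cw.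
have xw := ball_triangle (ball_triangle xy yz) zw.
apply: le_ball xw; lra.
Qed.

Lemma homeomorphic_hausdorff (X Y : topologicalType) :
  homeomorphic X Y -> hausdorff_space Y -> hausdorff_space X.
Proof.
move=> [h [g [hcont gcont hK gK]]] Yh p q pq.
apply: (can_inj hK); apply: Yh => A B hA hB.
have [x [Ax Bx]] := pq _ _ (hcont p _ hA) (hcont q _ hB).
by exists (h x).
Qed.

(** Fineness is asked of the tower in the target; exchanging the two towers will give the inverse
    map. *)
Lemma matched_tower_map (X Y : topologicalType) (n : nat -> nat)
    (U : nat -> nat -> set X) (V : nat -> nat -> set Y)
    (S : nat -> set (set Y)) :
  connected [set: Y] -> compact [set: Y] -> hausdorff_space Y ->
  (forall k, closed_chain (n k) (U k)) -> (forall k, closed_chain (n k) (V k)) ->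
  (forall k i, i <= n k.+1 -> exists j,
     [/\ j <= n k, U k.+1 i `<=` U k j & V k.+1 i `<=` V k j]) ->
  star_fine S -> (forall k, subordinate (S k) (n k.+1) (V k.+1)) ->
  exists f : X -> Y, continuous f /\
    forall x y, (forall k, exists i, [/\ i <= n k, U k i x & V k i y]) <-> y = f x.
Proof.
move=> Yconn Yc Yh Uch Vch UVref Sfine VS.
pose rel x y := forall k, exists i, [/\ i <= n k, U k i x & V k i y].
(* Meeting links of [U] have neighbouring indices, so the links of [V] with these indices meet too.
   Thus [V i], [V i'] and [V j] overlap successively, starting at [y]. The stage is shifted by one
   because [S k] controls [V k.+1]. *)
have star y W : nbhs y W -> exists k, forall x i i' j, i <= n k -> i' <= n k ->
    j <= n k -> U k i x -> U k i' x -> V k i y ->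
    (forall x', U k i' x' -> U k j x' -> V k j `<=` W).
  move=> yW; have [k Hk] := Sfine y W yW.
  exists k.+1 => x i i' j ni ni' nj Ui Ui' Vi x' Ui'' Uj.
  have [[_ _ Ud] _] := Uch k.+1.
  have adj a b t : a <= n k.+1 -> b <= n k.+1 -> U k.+1 a t -> U k.+1 b t ->
      V k.+1 a `&` V k.+1 b !=set0.
    move=> na nb Ua Ub; apply: (closed_chain_adjacent Yconn (Vch _) na nb).
      exact: (Ud _ _ _ nb na Ub Ua).
    exact: (Ud _ _ _ na nb Ua Ub).
  have [A SA iA] := VS _ _ ni; have [B SB iB] := VS _ _ ni'.
  have [C SC jC] := VS _ _ nj.
  apply: (subset_trans jC); apply: (Hk A B C) => //; first exact: iA.
    by have [t [Vt Vt']] := adj _ _ _ ni ni' Ui Ui'; exists t; split; [exact: iA|exact: iB].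
  by have [t [Vt Vt']] := adj _ _ _ ni' nj Ui'' Uj; exists t; split; [exact: iB|exact: jC].
have relex x : exists y, rel x y.
  (* The candidates for the image of [x] at stage [k]: closed nonempty sets that decrease with
     [k]. *)
  pose K k := \bigcup_(i in [set i | i <= n k /\ U k i x]) V k i.
  have Kdec k : K k.+1 `<=` K k.
    move=> y [i [ni Ui] Vi]; have [j [nj UU VV]] := UVref k i ni.
    by exists j; [split => //; exact: UU | exact: VV].
  have Kmono k d : K (k + d) `<=` K k.
    elim: d => [|d IH]; first by rewrite addn0.
    by rewrite addnS; exact: subset_trans (Kdec _) IH.
  have [|k l _ _|k _|k _|y Ky] := @directed_closed_meet Y _ setT K Yc.
  - by exists 0.
  - exists (k + l) => // y Ky; split; first exact: Kmono Ky.
    by move: Ky; rewrite addnC; exact: Kmono.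
  - have [i ni Ui] := weak_chain_cover x (Uch k).1.
    by have [y [Vy _]] := (Vch k).2 i ni; exists y, i.
  - by apply: closed_bigcup_le; have [[]] := Vch k.
  - by exists y => k; have [i [ni Ui] Vi] := Ky k I; exists i.
have [f fP] := choice relex.
have reluniq x y y' : rel x y -> rel x y' -> y' = y.
  move=> xy xy'; apply: contrapT => neq.
  have yW : nbhs y (~` [set y']).
    apply: open_nbhs_nbhs; split; last exact: nesym.
    exact/closed_openC/accessible_closed_set1/hausdorff_accessible.
  (* With [i' = j], the link [V j], which contains [y'], would lie in the complement of [y']. *)
  have [k Hk] := star y _ yW.
  have [i [ni Ui Vi]] := xy k; have [j [nj Uj Vj]] := xy' k.
  by have := Hk x i j j ni nj nj Ui Uj Vi x Uj Uj _ Vj; apply.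
exists f; split; last first.
  by move=> x y; split => [xy|->]; [exact: reluniq (fP x) xy | exact: fP].
move=> x W fxW; have [k Hk] := star _ _ fxW.
(* The interior of the link [i'] around [x] is the neighbourhood that [f] sends into [W]. *)
have [[_ Uint _] _] := Uch k; have [i' ni' Ui'] := Uint x.
have Ui'x := interior_subset Ui'.
apply: filterS Ui' => x' Ux'.
have [i [ni Ui Vi]] := fP x k; have [j [nj Uj Vj]] := fP x' k.
exact: (Hk x i i' j ni ni' nj Ui Ui'x Vi x' Ux' Uj _ Vj).
Qed.

(** Each stage makes one refinement led by [X] and one led by [Y], so both towers become fine. *)
Lemma matched_towers (X Y : topologicalType) (S : nat -> set (set X))
    (T : nat -> set (set Y)) :
  nondegenerate_pseudoarc X -> nondegenerate_pseudoarc Y ->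
  (forall k, open_cover (S k)) -> (forall k, open_cover (T k)) ->
  exists (n : nat -> nat) (U : nat -> nat -> set X) (V : nat -> nat -> set Y),
    [/\ (forall k, closed_chain (n k) (U k)) /\
        (forall k, closed_chain (n k) (V k)),
        forall k i, i <= n k.+1 -> exists j,
          [/\ j <= n k, U k.+1 i `<=` U k j & V k.+1 i `<=` V k j],
        forall k, subordinate (S k) (n k.+1) (U k.+1) &
        forall k, subordinate (T k) (n k.+1) (V k.+1)].
Proof.
move=> Xp Yp Sop Top.
pose state := (nat * ((nat -> set X) * (nat -> set Y)))%type.
pose good (s : state) := closed_chain s.1 s.2.1 /\ closed_chain s.1 s.2.2.
pose finer k (s s' : state) := [/\ forall i, i <= s'.1 -> exists j,
      [/\ j <= s.1, s'.2.1 i `<=` s.2.1 j & s'.2.2 i `<=` s.2.2 j],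
    subordinate (S k) s'.1 s'.2.1 & subordinate (T k) s'.1 s'.2.2].
(* Quantifying over all states, good or not, makes the step a total function by choice. *)
have step (ks : nat * state) : exists s', good ks.2 -> good s' /\ finer ks.1 ks.2 s'.
  case: ks => k [n [U V]] /=.
  have [[/= Uch Vch]|ngood] := pselect (good (n, (U, V))); last first.
    by exists (n, (U, V)).
  have [m [U' [V' [f [U'ch V'ch U'S fP]]]]] :=
    refine_matched_chains Xp Yp (Sop k) Uch Vch.
  have [l [V'' [U'' [g [V''ch U''ch V''T gP]]]]] :=
    refine_matched_chains Yp Xp (Top k) V'ch U'ch.
  exists (l, (U'', V'')) => _; split => //; split => //= i il.
    have [gm V''V' U''U'] := gP i il; have [fn U'U V'V] := fP _ gm.
    by exists (f (g i)); split => //; [exact: subset_trans U'U | exact: subset_trans V'V].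
  have [gm _ U''U'] := gP i il; have [A SA U'A] := U'S _ gm.
  by exists A => //; exact: subset_trans U'A.
have [F FP] := choice step.
pose s0 : state := (0, (fun _ => setT, fun _ => setT)).
pose t := fix t k := if k is k'.+1 then F (k', t k') else s0.
have trivial_chain (Z : topologicalType) : (exists x y : Z, x <> y) ->
    @closed_chain Z 0 (fun _ => setT).
  move=> [z _]; split; first split.
  - by move=> _ _; exact: closedT.
  - by move=> x; exists 0 => //; exact: filterT.
  - by move=> i j x; rewrite leqn0 => /eqP ->; rewrite leqn0 => /eqP ->.
  - by move=> i; rewrite leqn0 => /eqP ->; exists z; split => // j; lia.
have tgood k : good (t k).
  elim: k => [|k IH] /=; first by split; apply: trivial_chain; [case: Xp|case: Yp].
  by have [] := FP (k, t k) IH.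
have tfiner k : finer k (t k) (t k.+1) by have [] := FP (k, t k) (tgood k).
exists (fun k => (t k).1), (fun k => (t k).2.1), (fun k => (t k).2.2).
split; first by split=> k; have [] := tgood k.
- by move=> k i; have [+ _ _] := tfiner k; apply.
- by move=> k; have [_ + _] := tfiner k.
- by move=> k; have [_ _ +] := tfiner k.
Qed.

Theorem corollary4p13 (R : realType) (X Y : topologicalType)
    (hX : pseudoarc R X) (hY : pseudoarc R Y) :
  homeomorphic X Y.
Proof.
have ndp (Z : topologicalType) : pseudoarc R Z -> nondegenerate_pseudoarc Z.
  move=> [Z2 [Zconn [M ZM] Zc] Zch ZHI]; split => //; split => //.
  exact: homeomorphic_hausdorff ZM (@metric_hausdorff R M).
have [S [Sop Sfine]] : exists S : nat -> set (set X),
    (forall k, open_cover (S k)) /\ star_fine S.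
  by case: hX => _ [_ + _] _ _; exact: metrizable_star_fine.
have [T [Top Tfine]] : exists T : nat -> set (set Y),
    (forall k, open_cover (T k)) /\ star_fine T.
  by case: hY => _ [_ + _] _ _; exact: metrizable_star_fine.
have Xp := ndp _ hX; have Yp := ndp _ hY.
have [n [U [V [[Uch Vch] UVref US VT]]]] := matched_towers Xp Yp Sop Top.
have [[Xconn Xc Xh _ _] _] := Xp; have [[Yconn Yc Yh _ _] _] := Yp.
have [f [fcont fP]] := matched_tower_map Yconn Yc Yh Uch Vch UVref Tfine VT.
have VUref k i : i <= n k.+1 -> exists j,
    [/\ j <= n k, V k.+1 i `<=` V k j & U k.+1 i `<=` U k j].
  by move=> /UVref[j []]; exists j.
have [g [gcont gP]] := matched_tower_map Xconn Xc Xh Vch Uch VUref Sfine US.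
(* The relation of sharing an index at every stage is symmetric in the two towers, so it is the
   graph of [f] and the transposed graph of [g]. *)
have fg x y : y = f x <-> x = g y.
  rewrite -fP -gP.
  by split => H k; have [i []] := H k; exists i.
exists f, g; split => //.
  by move=> x; apply/esym/fg.
by move=> y; apply/esym/fg.
Qed.
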